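(* Let $F$ be a Banach lattice, let $A\subset F_+$, and let $\Phi:F\to F$ be defined by $\Phi(f)=rf^++sf^-$, where $r,s\in\mathbb{R}$ are fixed with $s\neq -r$. Then the norm closure $\overline{\operatorname{span}}\,\Phi(\operatorname{span}A)$ is the closed sublattice generated by $A$ in $F$, that is, the smallest norm-closed linear sublattice of $F$ containing $A$.
   Context: All vector spaces are real. $F_+$ is the positive cone, $f^+=f\vee 0$, $f^-=(-f)\vee 0$. $\Phi(\operatorname{span}A)=\{\Phi(f): f\in\operatorname{span}A\}$, and $\overline{\operatorname{span}}$ denotes the norm closure of the linear span. A (linear) sublattice is a linear subspace closed under the lattice operations. *)

(* Defs.v *)
From HB Require Import structures.
From mathcomp Require Import all_boot all_order all_algebra.
From mathcomp Require Import all_classical all_reals all_analysis.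

Set Implicit Arguments.
Unset Strict Implicit.
Unset Printing Implicit Defensive.

Import Order.TTheory GRing.Theory Num.Theory.
Import numFieldNormedType.Exports.

Local Open Scope classical_set_scope.
Local Open Scope ring_scope.

(* The order and the lattice operations are fields here, and not inherited
   from Order.Lattice, because Hierarchy Builder rejects a structure below
   both zmodType and latticeType that is not above realDomainType. The
   instances after the structure recover the Order.Lattice interface. *)
HB.mixin Record CompleteNormedModule_isBanachLattice (R : realType) F
    of CompleteNormedModule R F := {
  ble : rel F ;
  bmeet : F -> F -> F ;
  bjoin : F -> F -> F ;
  ble_refl : reflexive ble ;
  ble_anti : antisymmetric ble ;
  ble_trans : transitive ble ;
  ble_meet : forall x y z, ble x (bmeet y z) = ble x y && ble x z ;
  ble_join : forall x y z, ble (bjoin x y) z = ble x z && ble y z ;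
  bleD2r : forall x y z, ble x y -> ble (x + z) (y + z) ;
  ble_scale : forall (a : R) x, 0 <= a -> ble 0 x -> ble 0 (a *: x) ;
  (* bjoin x (- x) is the modulus of x *)
  ble_norm : forall x y,
    ble (bjoin x (- x)) (bjoin y (- y)) -> `|x| <= `|y|
}.

#[short(type="banachLatticeType")]
HB.structure Definition BanachLattice (R : realType) :=
  { F of CompleteNormedModule R F & CompleteNormedModule_isBanachLattice R F }.

HB.instance Definition _ (R : realType) (F : banachLatticeType R) :=
  Order.Le_isPOrder.Build ring_display (BanachLattice.sort F)
    ble_refl ble_anti ble_trans.
HB.instance Definition _ (R : realType) (F : banachLatticeType R) :=
  Order.POrder_MeetJoin_isLattice.Build ring_display (BanachLattice.sort F)
    ble_meet ble_join.

Section BanachLatticeDefs.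
Context {R : realType} {F : banachLatticeType R}.
Implicit Types (f : F) (A M : set F).

(* Order.join, since Num.max is not the supremum in a partial order. *)
Definition pospart f : F := Order.join f 0.
Definition negpart f : F := Order.join (- f) 0.

Definition Phi (r s : R) f : F := r *: pospart f + s *: negpart f.

Definition lspan A : set F :=
  [set f | exists (n : nat) (c : 'I_n -> R) (a : 'I_n -> F),
    (forall i, A (a i)) /\ f = \sum_(i < n) c i *: a i].

Definition linear_sublattice M : Prop :=
  [/\ GRing.submod_closed [in M], Order.ClosedPredicates.meet_closed [in M]
    & Order.ClosedPredicates.join_closed [in M]].

Definition closed_linear_sublattice M : Prop :=
  closed M /\ linear_sublattice M.

Definition closed_sublattice_generated A : set F :=
  smallest closed_linear_sublattice A.

Lemma closed_sublattice_generated_smallest A :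
  [/\ closed_linear_sublattice (closed_sublattice_generated A),
      A `<=` closed_sublattice_generated A
    & forall M, closed_linear_sublattice M -> A `<=` M ->
        closed_sublattice_generated A `<=` M].
Proof.
split; [|exact: sub_smallest|by move=> M CM AM; exact: smallest_sub].
split; first by apply: closed_bigI => M [[]].
have inP f : (f \in closed_sublattice_generated A) <->
    (forall M, closed_linear_sublattice M -> A `<=` M -> f \in M).
  rewrite inE; split=> [h M CM AM|h M [CM AM]]; first by rewrite inE; exact: h.
  by rewrite -inE; exact: h.
split; [split|..].
- by apply/inP => M [_ [[]]].
- move=> a u v /inP uI /inP vI; apply/inP => M CM AM.
  by have [_ [[_ +] _ _]] := CM; apply; [exact: uI|exact: vI].
- move=> u v /inP uI /inP vI; apply/inP => M CM AM.
  by have [_ [_ + _]] := CM; apply; [exact: uI|exact: vI].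
- move=> u v /inP uI /inP vI; apply/inP => M CM AM.
  by have [_ [_ _ +]] := CM; apply; [exact: uI|exact: vI].
Qed.

End BanachLatticeDefs.

(* Main.v *)
(* Since A lies in the positive cone, |a| = a for a in A, and the span of
   Phi(span A) is the span L of {|v| : v in span A}.  It remains to see that
   the closure of L is stable under the modulus, and only finitely many
   a_1, ..., a_n >= 0 in A matter at a time.  Let X be the standard simplex and
   let V be the space of linear forms on X; it contains the constant 1, which
   represents e = a_1 + ... + a_n.
   - On X, the span of {|v| : v in V} is uniformly dense in the closed algebra
     generated by V: by piecewise linear interpolation it approximates exp v,
     the functions exp v are stable under products, and multiplication by v is
     the derivative of multiplication by exp (t v).  This algebra is stable
     under the modulus (square root iteration).
   - Inequalities between lattice-linear expressions transfer from X to F: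
     write the expression as a meet of joins of linear forms and apply
     Fourier-Motzkin elimination to each join.
   So for f in L some g in L satisfies | |f| - g | <= d e, hence
   || |f| - g || <= d ||e||. *)
Require Import Defs.
From mathcomp Require Import all_boot all_order all_algebra.
From mathcomp Require Import all_classical all_reals all_analysis.
From mathcomp Require Import ring lra.

Import Order.TTheory GRing.Theory Num.Theory.
Import numFieldNormedType.Exports.

Local Open Scope classical_set_scope.
Local Open Scope ring_scope.

Set Implicit Arguments.
Unset Strict Implicit.
Unset Printing Implicit Defensive.

(** * Linear subspaces given as sets *)

Definition subspace (R : realType) (U : lmodType R) (S : set U) : Prop :=
  S 0 /\ forall (a : R) u v, S u -> S v -> S (a *: u + v).

Section Subspace.
Context {R : realType} {U : lmodType R} {S : set U} (hS : subspace S).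

Lemma subspace0 : S 0. Proof. by case: hS. Qed.

Lemma subspaceD u v : S u -> S v -> S (u + v).
Proof. by move=> Su Sv; rewrite -[u]scale1r; apply: (hS.2). Qed.

Lemma subspaceZ a u : S u -> S (a *: u).
Proof. by move=> Su; rewrite -[_ *: _]addr0; apply: (hS.2) => //; case: hS. Qed.

Lemma subspaceN u : S u -> S (- u).
Proof. by move=> Su; rewrite -scaleN1r; apply: subspaceZ. Qed.

Lemma subspaceB u v : S u -> S v -> S (u - v).
Proof. by move=> Su Sv; apply: subspaceD => //; apply: subspaceN. Qed.

Lemma subspace_sum (I : Type) (s : seq I) (P : pred I) (f : I -> U) :
  (forall i, P i -> S (f i)) -> S (\sum_(i <- s | P i) f i).
Proof.
by move=> Sf; elim/big_ind: _ => //; [exact: subspace0|exact: subspaceD].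
Qed.

End Subspace.

(** * Uniform closures and uniformly closed algebras of bounded functions *)

Section UniformAlgebra.
Context {R : realType} {X : Type}.
Implicit Types (S V : set (X -> R)) (f g v w : X -> R).

Definition bounded_fct f := exists C, forall x, `|f x| <= C.

Lemma bounded_fct_gt0 f : bounded_fct f ->
  exists2 C : R, 0 < C & forall x, `|f x| <= C.
Proof.
move=> [C hC]; exists (`|C| + 1) => [|x]; first by rewrite ltr_wpDl.
by rewrite (le_trans (hC x))// (le_trans (ler_norm C))// lerDl.
Qed.

Definition uniform_closure S : set (X -> R) :=
  [set f | forall e : R, 0 < e ->
    exists2 g, S g & forall x, `|f x - g x| <= e].

Lemma subset_uniform_closure S : S `<=` uniform_closure S.
Proof.
by move=> f Sf e e0; exists f => // x; rewrite subrr normr0 ltW.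
Qed.

Lemma uniform_closure_lim S f :
  uniform_closure (uniform_closure S) f -> uniform_closure S f.
Proof.
move=> Sf e e0; have e20 : 0 < e / 2 by lra.
have [g /(_ _ e20)[h Sh gh] fg] := Sf _ e20.
exists h => // x; move: (fg x) (gh x) => fgx ghx.
by rewrite -(subrKA (g x)) (le_trans (ler_normD _ _))//; lra.
Qed.

Lemma uniform_closure_subspace S : subspace S -> subspace (uniform_closure S).
Proof.
move=> hS; split; first exact/subset_uniform_closure/subspace0.
move=> a f g Sf Sg e e0; have a0 : 0 < `|a| + 1 by rewrite ltr_wpDl.
have [|f' Sf' ff'] := Sf (e / (2 * (`|a| + 1))); first by rewrite divr_gt0//; lra.
have [|g' Sg' gg'] := Sg (e / 2); first by lra.
exists (a *: f' + g'); first exact: hS.2.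
move=> x; rewrite !fctE.
rewrite (_ : _ - _ = a * (f x - f' x) + (g x - g' x)); last first.
  by rewrite /GRing.scale/=; ring.
rewrite (le_trans (ler_normD _ _))// normrM.
have : `|a| * `|f x - f' x| <= (`|a| + 1) * (e / (2 * (`|a| + 1))).
  by apply: ler_pM => //; lra.
rewrite (_ : _ * (e / _) = e / 2); last by field; lra.
by move: (gg' x); lra.
Qed.

(** Inductive, so that the multiplier argument below can recurse on membership. Approximants form a
    family indexed by [nat], which yields an induction hypothesis for each of them. Scalar multiples
    arise as products once [V] contains the constants. *)
Inductive uniform_algebra V : (X -> R) -> Prop :=
| uniform_algebra_base v : V v -> uniform_algebra V v
| uniform_algebraD f g : uniform_algebra V f -> uniform_algebra V g ->
    uniform_algebra V (f + g)
| uniform_algebraM f g : uniform_algebra V f -> uniform_algebra V g ->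
    uniform_algebra V (f \* g)
| uniform_algebra_lim f (h : nat -> X -> R) :
    (forall k, uniform_algebra V (h k)) ->
    (forall e : R, 0 < e -> exists k, forall x, `|f x - h k x| <= e) ->
    uniform_algebra V f.

Section AlgebraTheory.
Context {V : set (X -> R)} (hV : subspace V) (V1 : V (cst 1))
  (Vbd : forall v, V v -> bounded_fct v).

Lemma base_cst c : V (cst c).
Proof.
rewrite (_ : cst c = c *: cst 1); first exact: subspaceZ.
by apply/funext => x; rewrite !fctE; rewrite /GRing.scale/= mulr1.
Qed.

Lemma uniform_algebraZ c f : uniform_algebra V f -> uniform_algebra V (c *: f).
Proof. by move=> Vf; exact/(uniform_algebraM (uniform_algebra_base (base_cst c))). Qed.

Lemma uniform_algebra_bounded f : uniform_algebra V f -> bounded_fct f.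
Proof.
elim=> {f}[v /Vbd//|f g _ [C fC] _ [D gD]|f g _ [C fC] _ [D gD]|].
- exists (C + D) => x; rewrite (le_trans (ler_normD _ _))//.
  by rewrite lerD.
- by exists (C * D) => x; rewrite normrM ler_pM.
- move=> f h _ bh /(_ 1 ltr01)[k fhk]; have [C hC] := bh k.
  exists (C + 1) => x; rewrite -[f x](subrK (h k x)).
  by rewrite (le_trans (ler_normD _ _))// addrC lerD.
Qed.

(* On [[-1, 1]] these increase to [`|t|], with error at most [2 / (k + 1)]. *)
Fixpoint abs_approx (k : nat) (t : R) : R :=
  if k is k'.+1 then
    abs_approx k' t + 2^-1 * (t * t + - 1 * (abs_approx k' t * abs_approx k' t))
  else 0.

(** With [q] the iterate and [d = |t| - q], the next error is [d (1 - (|t| + q) / 2)], at most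
    [d (1 - d / 2)] because [d <= |t| + q]; this recursion keeps [d <= 2 / (k + 1)]. *)
Lemma abs_approxP k (t : R) : `|t| <= 1 ->
  [/\ 0 <= abs_approx k t, abs_approx k t <= `|t| &
      (`|t| - abs_approx k t) * k.+1%:R <= 2].
Proof.
move=> t1; elim: k => [|k]/=; first by rewrite subr0 mulr1; split => //; lra.
rewrite -[t * t]/(t ^+ 2) -real_normK ?num_real//.
move: (abs_approx k t) => q; set a := `|t| in t1 *; have a0 : 0 <= a := normr_ge0 _.
rewrite -[in k.+2]addn1 natrD.
have : 1 <= k.+1%:R :> R by rewrite ler1n.
move: (k.+1%:R) => m m1 [q0 qa hq].
split; [nra|nra|].
suff : (a - q) * (2 - (a - q)) * (m + 1) <= 4.
  have -> : q + 2^-1 * (a ^+ 2 + -1 * (q * q)) =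
    a - 2^-1 * ((a - q) * (2 - (a - q))) + q * (a - q) by field.
  by have : 0 <= q * (a - q) * (m + 1); [by rewrite !mulr_ge0//; lra|lra].
have : 0 <= (2 - (a - q) * m) * (2 - (a - q)) by rewrite mulr_ge0//; lra.
have : 0 <= (a - q) ^+ 2 by rewrite sqr_ge0.
lra.
Qed.

(** Division by a bound of [f] brings the values into [[-1, 1]], where the iterates [abs_approx k],
    polynomials in the rescaled function, converge uniformly. *)
Lemma uniform_algebra_abs f :
  uniform_algebra V f -> uniform_algebra V (fun x => `|f x|).
Proof.
move=> Vf; have [C C0 fC] := bounded_fct_gt0 (uniform_algebra_bounded Vf).
set g := C^-1 *: f; have Vg : uniform_algebra V g by exact: uniform_algebraZ.
have g1 x : `|g x| <= 1.
  rewrite /g fctE /GRing.scale/= normrM normfV (gtr0_norm C0).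
  by rewrite mulrC ler_pdivrMr// mul1r.
suff Vag : uniform_algebra V (fun x => `|g x|).
  rewrite (_ : (fun x => _) = C *: (fun x => `|g x|)).
    exact: uniform_algebraZ.
  apply/funext => x; rewrite /g !fctE /GRing.scale/= normrM normfV.
  by rewrite (gtr0_norm C0) mulVKf// gt_eqF.
apply: (uniform_algebra_lim (h := fun k x => abs_approx k (g x))).
  elim=> [|k IH]; first exact: uniform_algebra_base (base_cst 0).
  (* The recursion of [abs_approx] is spelled with [- 1 *] so that it is convertible to these sums,
     products and multiples. *)
  have Vgg := uniform_algebraM Vg Vg.
  have Vhh := uniform_algebraZ (- 1) (uniform_algebraM IH IH).
  by have /(uniform_algebraD IH) :=
    uniform_algebraZ 2^-1 (uniform_algebraD Vgg Vhh).
move=> e e0; have [k hk] : exists k : nat, 2 / e < k.+1%:R.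
  exists (Num.truncn (2 / e)); exact: truncnS_gt.
exists k => x; have [q0 qg hq] := abs_approxP k (g1 x).
rewrite ger0_norm ?subr_ge0//.
move: hk; rewrite ltr_pdivrMr// mulrC => hk.
have k0 : 0 < k.+1%:R :> R by [].
by rewrite -(ler_pM2r k0); lra.
Qed.

End AlgebraTheory.
End UniformAlgebra.

(** * Piecewise linear interpolation and bounds for the exponential *)

Section Interpolation.
Context {R : realType}.
Implicit Types (psi : R -> R) (a d s t : R).

(** The positive part, written with the modulus because [S] below is assumed to contain the moduli
    of elements of [V]. *)
Definition ramp s : R := 2^-1 * (`|s| + s).

Lemma ramp_ge0 s : 0 <= s -> ramp s = s.
Proof. by move=> s0; rewrite /ramp ger0_norm//; field. Qed.

Lemma ramp_le0 s : s <= 0 -> ramp s = 0.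
Proof. by move=> s0; rewrite /ramp ler0_norm// addNr mulr0. Qed.

(* Piecewise linear interpolation of [psi] at the knots [a + i d], [i <= m],
   constant beyond the extreme knots. *)
Fixpoint interpolant psi a d (m : nat) s : R :=
  if m is m'.+1 then
    interpolant psi a d m' s +
    (psi (a + m'.+1%:R * d) - psi (a + m'%:R * d)) / d *
      (ramp (s - (a + m'%:R * d)) - ramp (s - (a + m'.+1%:R * d)))
  else psi a.

(** A new segment changes nothing to the left of its first knot and, by the second claim, starts
    there from a constant. On the segment the variation of [psi] and the new term are each at most
    [L d]. *)
Lemma interpolantP psi a b d L m s : 0 < d -> 0 <= L ->
  (forall t u, a <= t <= b -> a <= u <= b ->
     `|psi t - psi u| <= L * `|t - u|) ->
  a + m%:R * d <= b -> a <= s <= b ->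
  (s <= a + m%:R * d -> `|psi s - interpolant psi a d m s| <= 2 * L * d) /\
  (a + m%:R * d <= s -> interpolant psi a d m s = psi (a + m%:R * d)).
Proof.
move=> d0 L0 psiL; elim: m => [|m IH]/= mb sab.
  rewrite mul0r addr0; split=> // sa; have -> : s = a by lra.
  by rewrite subrr normr0 mulr_ge0 ?mulr_ge0// ltW.
have m0 : 0 <= m%:R * d by rewrite mulr_ge0// ltW.
move: mb; rewrite -natr1 mulrDl mul1r.
set t := a + m%:R * d; set u := a + _ => ub.
have uE : u = t + d by rewrite /u /t addrA.
have a_t : a <= t by rewrite /t; lra.
have t_b : t <= b by move: ub; rewrite uE; lra.
have [IH1 IH2] := IH t_b sab.
have ut : `|psi u - psi t| <= L * d.
  have -> : d = `|u - t| by rewrite uE [t + _]addrC addrK gtr0_norm.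
  by apply: psiL; rewrite ?a_t// uE; lra.
split=> su.
- have [st|ts] := leP s t.
    rewrite (ramp_le0 (s := s - t)) ?(ramp_le0 (s := s - u)); try by lra.
    by rewrite subrr mulr0 addr0; exact: IH1.
  rewrite (IH2 (ltW ts)) (ramp_ge0 (s := s - t)) ?(ramp_le0 (s := s - u)); try by lra.
  rewrite subr0 opprD addrA (le_trans (ler_normB _ _))//.
  have -> : 2 * L * d = L * d + L * d by ring.
  apply: lerD.
    have /le_trans-> // : `|psi s - psi t| <= L * `|s - t|.
      by apply: psiL => //; rewrite a_t.
    by rewrite ler_wpM2l// ger0_norm; lra.
  rewrite normrM normrM normfV (gtr0_norm d0) -mulrA.
  rewrite -[leRHS]mulr1 ler_pM//; first by rewrite mulr_ge0// invr_ge0 ltW.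
  by rewrite mulrC ler_pdivrMr// mul1r ger0_norm; lra.
- have ts : t <= s by rewrite uE in su; lra.
  rewrite (IH2 ts) !ramp_ge0 ?subr_ge0//.
  have -> : s - t - (s - u) = d by rewrite uE; ring.
  by rewrite divfK ?gt_eqF// subrKC.
Qed.

Lemma expR_lipschitz (B s t : R) : s <= B -> t <= B ->
  `|expR s - expR t| <= expR B * `|s - t|.
Proof.
wlog ts : s t / t <= s => [hw sB tB|sB tB].
  case: (leP t s) => [|/ltW] h; first exact: hw.
  by rewrite distrC [`|s - t|]distrC hw.
rewrite !ger0_norm ?subr_ge0 ?ler_expR//.
have -> : expR s - expR t = expR s * (1 - expR (t - s)).
  by rewrite mulrBr mulr1 -expRD subrKC.
apply: ler_pM; rewrite ?expR_ge0 ?ler_expR//.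
  by rewrite subr_ge0 -[1]expR0 ler_expR; lra.
by have := expR_ge1Dx (t - s); lra.
Qed.

(** From [1 - h <= expR (- h)] one gets [expR h <= 1 / (1 - h)], so the remainder is at most
    [h ^+ 2 / (1 - h)], and [1 - h >= 1 / 2]. *)
Lemma expR_taylor1 (h : R) : `|h| <= 1 / 2 -> `|expR h - 1 - h| <= 2 * h ^+ 2.
Proof.
rewrite ler_norml => /andP[h1 h2]; have := expR_ge1Dx h => hh.
rewrite ger0_norm; last by lra.
have := expR_ge1Dx (- h); rewrite expRN.
have e0 := expR_gt0 h.
rewrite -(ler_pM2r e0) mulVf ?gt_eqF// => H.
nra.
Qed.

End Interpolation.

(** * Uniform density of the span of moduli in the generated algebra *)

Section ModulusDensity.
Context {R : realType} {X : Type} {V S : set (X -> R)}.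
Hypotheses (hV : subspace V) (V1 : V (cst 1))
  (Vbd : forall v, V v -> bounded_fct v).
Hypotheses (hS : subspace S) (VS : V `<=` S)
  (absS : forall v, V v -> S (fun x => `|v x|)).

Let U := uniform_closure S.
Let hU : subspace U := uniform_closure_subspace hS.

Lemma ramp_comp v c : V v -> S (fun x => ramp (v x - c)).
Proof.
move=> Vv; have Vvc : V (v - cst c) by apply: subspaceB => //; exact: base_cst.
exact: (subspaceZ hS 2^-1 (subspaceD hS (absS Vvc) (VS Vvc))).
Qed.

(** An interpolant of [psi] composed with [v] is a combination of constants and ramps of [v - c],
    hence lies in [S]. *)
Lemma lipschitz_comp (psi : R -> R) (B L : R) v : 0 < B -> 0 <= L -> V v ->
  (forall x, `|v x| <= B) ->
  (forall s t, - B <= s <= B -> - B <= t <= B ->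
     `|psi s - psi t| <= L * `|s - t|) ->
  U (psi \o v).
Proof.
move=> B0 L0 Vv vB psiL e e0.
(* With mesh [d = 2 B / (N + 1)] on [[-B, B]] the interpolation error [2 L d] is
   [4 L B / (N + 1)]. *)
have [N hN] : exists N : nat, 4 * L * B / e < N.+1%:R.
  exists (Num.truncn (4 * L * B / e)); exact: truncnS_gt.
have N0 : 0 < N.+1%:R :> R by [].
pose d := 2 * B / N.+1%:R; have d0 : 0 < d by rewrite divr_gt0//; lra.
have NB : - B + N.+1%:R * d = B by rewrite /d mulrC divfK ?gt_eqF//; ring.
exists (fun x => interpolant psi (- B) d N.+1 (v x)).
  elim: {NB hN N0} N.+1 => [|m IH]/=; first exact/VS/base_cst.
  apply: (subspaceD hS IH).
  apply: (subspaceZ hS _ (subspaceB hS _ _)); exact: ramp_comp.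
move=> x; have vx : - B <= v x <= B by rewrite -ler_norml.
have [|/(_ _)/le_trans->//] := interpolantP d0 L0 psiL _ vx (m := N.+1).
- by rewrite NB.
- by rewrite NB; lra.
move: hN; rewrite ltr_pdivrMr// /d mulrA ler_pdivrMr//; lra.
Qed.

Lemma expR_comp v : V v -> U (expR \o v).
Proof.
move=> Vv; have [B B0 vB] := bounded_fct_gt0 (Vbd Vv).
apply: (lipschitz_comp B0 (expR_ge0 B)) => // s t sB tB.
by apply: expR_lipschitz; lra.
Qed.

Lemma uniform_closure_bounded_mul f (h : nat -> X -> R) g : bounded_fct g ->
  (forall k, U (h k \* g)) ->
  (forall e : R, 0 < e -> exists k, forall x, `|f x - h k x| <= e) ->
  U (f \* g).
Proof.
move=> /bounded_fct_gt0[C C0 gC] Uhg hf; apply: uniform_closure_lim => e e0.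
have [|k hk] := hf (e / C); first exact: divr_gt0.
exists (h k \* g); [exact: Uhg|move=> x].
rewrite -[_ - _]/(f x * g x - h k x * g x) -mulrBl normrM.
by rewrite -[leRHS](divfK (lt0r_neq0 C0)) ler_pM.
Qed.

(* Multiplication by [v] is the derivative at [0] of multiplication by
   [expR (t v)], which permutes the functions [expR \o v], [v \in V]. *)
Lemma expR_multiplier w g : V w -> bounded_fct g ->
  (forall v, V v -> U (g \* (expR \o v))) ->
  forall v, V v -> U ((w \* g) \* (expR \o v)).
Proof.
move=> Vw bg Ug v Vv.
have [B B0 wB] := bounded_fct_gt0 (Vbd Vw).
have [C C0 vC] := bounded_fct_gt0 (Vbd Vv).
have [D D0 gD] := bounded_fct_gt0 bg.
pose K := D * expR C * (2 * B ^+ 2); have K0 : 0 < K.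
  by rewrite !mulr_gt0// ?expR_gt0// exprn_gt0.
apply: uniform_closure_lim => e e0.
(* The second bound gives [|t w| <= 1 / 2], as [expR_taylor1] requires; the difference quotient is
   then off by at most [t K], which the first bound makes at most [e]. *)
pose t := Num.min (e / K) (1 / 2 / B).
have t0 : 0 < t by rewrite lt_min !divr_gt0.
have te : t * K <= e by rewrite -ler_pdivlMr// ge_min lexx.
have tB : t * B <= 1 / 2 by rewrite -ler_pdivlMr// ge_min lexx orbT.
exists (t^-1 *: (g \* (expR \o (t *: w + v)) - g \* (expR \o v))).
  apply/(subspaceZ hU)/(subspaceB hU); apply: Ug => //.
  exact: hV.2.
move=> x; rewrite !fctE /= /GRing.scale/= expRD.
have -> : w x * g x * expR (v x) -
    t^-1 * (g x * (expR (t * w x) * expR (v x)) - g x * expR (v x)) =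
    - (g x * expR (v x) * (t^-1 * (expR (t * w x) - 1 - t * w x))).
  by field; rewrite gt_eqF.
rewrite normrN !normrM (gtr0_norm (expR_gt0 _)) normfV (gtr0_norm t0).
apply: le_trans te.
have -> : t * K = D * expR C * (2 * B ^+ 2 * t) by rewrite /K; ring.
apply: ler_pM => //; first by rewrite mulr_ge0// ?mulr_ge0// ?invr_ge0 ?expR_ge0// ltW.
  by apply: ler_pM; rewrite ?expR_ge0 ?ler_expR// (le_trans (ler_norm _)).
rewrite mulrC ler_pdivrMr//.
have twB : `|t * w x| <= t * B by rewrite normrM (gtr0_norm t0) ler_pM2l.
apply: le_trans (expR_taylor1 _) _; first exact: le_trans twB tB.
have -> : 2 * B ^+ 2 * t * t = 2 * (t * B) ^+ 2 by ring.
rewrite ler_pM2l// -[leLHS]real_normK ?num_real//.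
by rewrite lerXn2r// nnegrE ?normr_ge0// mulr_ge0// ltW.
Qed.

(** Products in [U] are not directly accessible, so the induction proves that [f] acts as a
    multiplier on every bounded [g] with all [g expR(v)] in [U]. Letting [g] vary turns the product
    case into composition of multipliers; [g = 1], [v = 0] gives back [f]. *)
Lemma uniform_algebra_modulus : uniform_algebra V `<=` U.
Proof.
suff H f : uniform_algebra V f -> forall g, bounded_fct g ->
    (forall v, V v -> U (g \* (expR \o v))) ->
    forall v, V v -> U ((f \* g) \* (expR \o v)).
  move=> f Vf; have V0 : V (cst 0) by exact: base_cst.
  have -> : f = (f \* cst 1) \* (expR \o cst 0).
    by apply/funext => x; rewrite /= expR0 !mulr1.
  apply: H => //; first by exists 1 => x; rewrite normr1.
  move=> v Vv; have -> : cst 1 \* (expR \o v) = expR \o v.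
    by apply/funext => x; rewrite /= mul1r.
  exact: expR_comp.
elim=> {f}[w Vw g|f1 f2 _ IH1 _ IH2 g bg Ug v Vv
  |f1 f2 _ IH1 V2 IH2 g bg Ug v Vv|f h _ IH hf g bg Ug v Vv].
- exact: expR_multiplier.
- have -> : ((f1 + f2) \* g) \* (expR \o v) =
      (f1 \* g) \* (expR \o v) + (f2 \* g) \* (expR \o v).
    by apply/funext => x; rewrite !fctE /=; ring.
  by apply: (subspaceD hU); [exact: IH1|exact: IH2].
- have -> : ((f1 \* f2) \* g) = (f1 \* (f2 \* g)).
    by apply/funext => x; rewrite /= mulrA.
  apply: IH1 => //; last by move=> u Vu; exact: IH2.
  have [C fC] := uniform_algebra_bounded Vbd V2; have [D gD] := bg.
  by exists (C * D) => x; rewrite normrM ler_pM.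
- have mulA f' : (f' \* g) \* (expR \o v) = f' \* (g \* (expR \o v)).
    by apply/funext => x; rewrite /= mulrA.
  rewrite mulA; apply: (uniform_closure_bounded_mul (h := h)) => //.
    have [C C0 vC] := bounded_fct_gt0 (Vbd Vv); have [D gD] := bg.
    exists (D * expR C) => x; rewrite normrM ler_pM//= gtr0_norm ?expR_gt0//.
    by rewrite ler_expR (le_trans (ler_norm _)).
  by move=> k; rewrite -mulA; exact: IH.
Qed.

End ModulusDensity.

(** * Identities and inequalities in vector lattices *)

Section VectorLattice.
Context {R : realType} {F : banachLatticeType R}.
Implicit Types (x y z w : F) (a : R).

Lemma bl_leD2r z x y : (x + z <= y + z) = (x <= y).
Proof.
apply/idP/idP => [h|]; last exact: bleD2r.
by rewrite -[x](addrK z) -[y](addrK z); exact: bleD2r.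
Qed.

Lemma bl_leD2l z x y : (z + x <= z + y) = (x <= y).
Proof. by rewrite ![z + _]addrC bl_leD2r. Qed.

Lemma bl_leBrDr x y z : (x - z <= y) = (x <= y + z).
Proof. by rewrite -(bl_leD2r z (x - z)) subrK. Qed.

Lemma bl_leBrDl x y z : (x + z <= y) = (x <= y - z).
Proof. by rewrite -(bl_leD2r z x (y - z)) subrK. Qed.

Lemma bl_subr_ge0 x y : (0 <= y - x) = (x <= y).
Proof. by rewrite -(bl_leD2r x 0) add0r subrK. Qed.

Lemma bl_leD x y z w : x <= y -> z <= w -> x + z <= y + w.
Proof.
by move=> xy zw; apply: (@le_trans _ _ (y + z)); rewrite ?bl_leD2r ?bl_leD2l.
Qed.

Lemma bl_leN x y : (- x <= - y) = (y <= x).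
Proof. by rewrite -[RHS]bl_subr_ge0 -[LHS]bl_subr_ge0 opprK addrC. Qed.

Lemma bl_leNr x y : (x <= - y) = (y <= - x).
Proof. by rewrite -[LHS]bl_leN opprK. Qed.

Lemma bl_scale_ge0 a x : 0 <= a -> 0 <= x -> 0 <= a *: x.
Proof. exact: ble_scale. Qed.

Lemma bl_leZ a x y : 0 <= a -> x <= y -> a *: x <= a *: y.
Proof.
by move=> a0 xy; rewrite -bl_subr_ge0 -scalerBr bl_scale_ge0// bl_subr_ge0.
Qed.

Lemma bl_leZ_pos a x y : 0 < a -> (a *: x <= a *: y) = (x <= y).
Proof.
move=> a0; apply/idP/idP; last exact/bl_leZ/ltW.
by move=> /(@bl_leZ a^-1 _ _); rewrite !scalerK ?gt_eqF// invr_ge0 => ->//; exact: ltW.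
Qed.

Lemma bl_joinDr x y z : Order.join x y + z = Order.join (x + z) (y + z).
Proof.
apply/le_anti/andP; split; last by rewrite leUx !bl_leD2r leUl leUr.
by rewrite bl_leBrDl leUx -!bl_leBrDl leUl leUr.
Qed.

Lemma bl_oppr_join x y : - Order.join x y = Order.meet (- x) (- y).
Proof.
apply/le_anti/andP; split; first by rewrite lexI !bl_leN leUl leUr.
by rewrite bl_leNr leUx !(bl_leNr _ (Order.meet _ _)) leIl leIr.
Qed.

Lemma bl_oppr_meet x y : - Order.meet x y = Order.join (- x) (- y).
Proof. by apply: oppr_inj; rewrite bl_oppr_join !opprK. Qed.

Lemma bl_meetDr x y z : Order.meet x y + z = Order.meet (x + z) (y + z).
Proof.
by apply: oppr_inj; rewrite opprD !bl_oppr_meet bl_joinDr -!opprD.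
Qed.

Lemma bl_scale_join a x y : 0 <= a ->
  a *: Order.join x y = Order.join (a *: x) (a *: y).
Proof.
rewrite le_eqVlt => /predU1P[<-|a0]; first by rewrite !scale0r joinxx.
apply/le_anti/andP; split; last by rewrite leUx !bl_leZ_pos// leUl leUr.
rewrite -[leRHS](scalerKV (lt0r_neq0 a0)) bl_leZ_pos// leUx.
by rewrite -!(bl_leZ_pos _ (_^-1 *: _) a0) !(scalerKV (lt0r_neq0 a0)) leUl leUr.
Qed.

Lemma bl_scale_meet a x y : 0 <= a ->
  a *: Order.meet x y = Order.meet (a *: x) (a *: y).
Proof.
move=> a0; apply: oppr_inj.
by rewrite -scalerN !bl_oppr_meet bl_scale_join// !scalerN.
Qed.

Lemma bl_joinD_meet x y : Order.join x y + Order.meet x y = x + y.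
Proof.
have -> : Order.meet x y = Order.meet (- y) (- x) + (x + y).
  by rewrite bl_meetDr addKr [x + y]addrC addKr.
by rewrite -bl_oppr_join addrA joinC subrr add0r.
Qed.

(** Adding the join [t] to a meet turns it into a sum by [bl_joinD_meet]; joins commute with
    translations, so the claim splits into the cases [u = x] and [u = y]. *)
Lemma bl_meetUl x y z :
  Order.meet (Order.join x y) z = Order.join (Order.meet x z) (Order.meet y z).
Proof.
apply/le_anti/andP; split; last first.
  by rewrite leUx !lexI !leIr !andbT !(le_trans (leIl _ _)) ?leUl ?leUr.
set w := Order.join (Order.meet x z) _; set t := Order.join (Order.join x y) z.
have key u : Order.meet u z <= w -> u <= Order.join x y -> u + z <= w + t.
  move=> uw ut; rewrite -bl_joinD_meet addrC bl_leD//.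
  by rewrite leUx (le_trans ut) ?leUl//= leUr.
rewrite -(bl_leD2l t) bl_joinD_meet [t + _]addrC bl_joinDr leUx.
by rewrite !key ?leUl ?leUr.
Qed.

Lemma bl_joinIl x y z :
  Order.join (Order.meet x y) z = Order.meet (Order.join x z) (Order.join y z).
Proof.
by apply: oppr_inj; rewrite bl_oppr_join !bl_oppr_meet bl_meetUl -!bl_oppr_join.
Qed.

Definition bl_abs x : F := Order.join x (- x).

Lemma bl_absN x : bl_abs (- x) = bl_abs x.
Proof. by rewrite /bl_abs opprK joinC. Qed.

Lemma bl_abs_ge x : x <= bl_abs x. Proof. exact: leUl. Qed.

Lemma bl_abs_le x y : (bl_abs x <= y) = (x <= y) && (- x <= y).
Proof. by rewrite leUx. Qed.

Lemma bl_ge0_abs x : 0 <= x -> bl_abs x = x.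
Proof.
move=> x0; apply/le_anti; rewrite bl_abs_ge andbT bl_abs_le lexx/=.
by rewrite (le_trans _ x0)// -oppr0 bl_leN.
Qed.

Lemma bl_abs_dist x y : bl_abs (bl_abs x - bl_abs y) <= bl_abs (x - y).
Proof.
have key u v : bl_abs u - bl_abs v <= bl_abs (u - v).
  rewrite bl_leBrDr bl_abs_le; apply/andP; split.
    by rewrite -[leLHS](subrK v) bl_leD// bl_abs_ge.
  by rewrite -{1}[u](subrK v) opprD bl_leD// /bl_abs leUr.
by rewrite bl_abs_le key/= opprB -[leRHS]bl_absN opprB key.
Qed.

Lemma bl_norm_le x y : bl_abs x <= bl_abs y -> `|x| <= `|y|.
Proof. exact: ble_norm. Qed.

Lemma bl_joinE x y : Order.join x y = 2^-1 *: (x + y + bl_abs (x - y)).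
Proof.
apply: (@scalerI _ _ 2) => //; rewrite scalerA divff// scale1r.
rewrite /bl_abs addrC bl_joinDr opprB.
have -> : x - y + (x + y) = 2 *: x by rewrite addrACA addNr addr0 scaler_nat mulr2n.
have -> : y - x + (x + y) = 2 *: y.
  by rewrite [x + y]addrC addrACA addNr addr0 scaler_nat mulr2n.
by rewrite bl_scale_join.
Qed.

Lemma bl_pospart x : pospart x = 2^-1 *: (bl_abs x + x).
Proof. by rewrite /pospart bl_joinE subr0 addr0 addrC. Qed.

Lemma bl_negpart x : negpart x = 2^-1 *: (bl_abs x - x).
Proof. by rewrite /negpart -[Order.join _ _]/(pospart (- x)) bl_pospart bl_absN. Qed.

Lemma bl_sum_ge0 (I : Type) (s : seq I) (P : pred I) (f : I -> F) :
  (forall i, P i -> 0 <= f i) -> 0 <= \sum_(i <- s | P i) f i.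
Proof.
move=> f0; elim/big_ind: _ => // u v u0 v0.
by rewrite -[leLHS]addr0 bl_leD.
Qed.

End VectorLattice.

(** * Elimination of variables from linear inequalities *)

Section Elimination.
Context {R : realType}.

Lemma lt_seq_below (Q : seq R) (m : R) : (forall q, q \in Q -> m < q) ->
  exists2 t, m < t & forall q, q \in Q -> t < q.
Proof.
elim: Q => [|q Q IH] mQ; first by exists (m + 1) => //; rewrite ltrDl.
have mq : m < q by apply: mQ; rewrite mem_head.
have [|t mt tQ] := IH; first by move=> r rQ; apply: mQ; rewrite in_cons rQ orbT.
exists (Num.min t ((m + q) / 2)); first by rewrite lt_min mt/=; lra.
move=> r; rewrite in_cons gt_min => /predU1P[->|/tQ->//].
by apply/orP; right; lra.
Qed.

(** Serves to choose the eliminated variable: [P] and [Q] are its lower and upper bounds, and [m] is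
    its sign constraint [0]. *)
Lemma lt_seq_between (P Q : seq R) (m : R) : (forall q, q \in Q -> m < q) ->
  (forall p q, p \in P -> q \in Q -> p < q) ->
  exists t, [/\ m < t, forall p, p \in P -> p < t &
                forall q, q \in Q -> t < q].
Proof.
elim: P => [|p P IH] mQ PQ; first by have [t] := lt_seq_below mQ; exists t.
have [|t [mt Pt tQ]] := IH mQ.
  by move=> r q rP; apply: PQ; rewrite in_cons rP orbT.
have [|u] := @lt_seq_below Q (Num.max t p).
  by move=> q qQ; rewrite gt_max tQ//= PQ// mem_head.
rewrite gt_max => /andP[tu pu] uQ; exists u; split=> //.
  exact: lt_trans tu.
by move=> r; rewrite in_cons => /predU1P[->//|/Pt/lt_trans->].
Qed.

(* Fourier-Motzkin elimination of the last variable, performed simultaneously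
   on real points and in [F]: the combinations of the constraints are
   normalised to be convex, so that they keep the bound [z]. *)
Lemma max_linear_ge0 (F : banachLatticeType R) n (a : nat -> F)
    (ls : seq (nat -> R)) (z : F) :
  (forall i, 0 <= a i) ->
  (forall x : nat -> R, (forall i, 0 <= x i) ->
     exists2 l, l \in ls & 0 <= \sum_(i < n) l i * x i) ->
  (forall l, l \in ls -> \sum_(i < n) l i *: a i <= z) ->
  0 <= z.
Proof.
move=> a0; elim: n ls => [|n IH] ls hx hz.
  have [//|l lls _] := hx (fun=> 0).
  by have := hz _ lls; rewrite big_ord0.
pose comb (l l' : nat -> R) i := (l n * l' i - l' n * l i) / (l n - l' n).
pose pos := [seq l : nat -> R <- ls | 0 < l n].
pose neg := [seq l : nat -> R <- ls | l n < 0].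
(* Forms positive in the last variable are also kept on their own: this is elimination against
   [0 <= x n], and in [F] the bound [z] survives since the dropped term is nonnegative. *)
pose nneg := [seq l : nat -> R <- ls | 0 <= l n].
apply: (IH (nneg ++ [seq comb l l' | l <- pos, l' <- neg])).
(* If all eliminated forms were negative at [x], some [t > 0] as last coordinate would make every
   form of [ls] negative, against [hx]. *)
- move=> x x0; apply: contrapT => hcon.
  have {hcon}hlt l : l \in nneg ++ [seq comb l l' | l <- pos, l' <- neg] ->
      \sum_(i < n) l i * x i < 0.
    by move=> lin; rewrite ltNge; apply/negP => h; apply: hcon; exists l.
  pose sx (l : nat -> R) := \sum_(i < n) l i * x i.
  have pos_lt l : l \in pos -> sx l < 0.
    rewrite mem_filter => /andP[l0 lls]; apply: hlt.
    by rewrite mem_cat mem_filter lls ltW.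
  have comb_lt l l' : l \in pos -> l' \in neg ->
      sx l' / - l' n < - sx l / l n.
    move=> lp ln; have := lp; have := ln.
    rewrite !mem_filter => /andP[l'0 _] /andP[l0 _].
    have : sx (comb l l') < 0.
      by apply: hlt; rewrite mem_cat; apply/orP; right; apply: allpairs_f.
    have -> : sx (comb l l') = (l n * sx l' - l' n * sx l) / (l n - l' n).
      rewrite /sx !mulr_sumr -sumrB mulr_suml; apply: eq_bigr => i _.
      by rewrite /comb; ring.
    rewrite ltr_pdivrMr ?mul0r; last by lra.
    rewrite ltr_pdivrMr ?oppr_gt0// mulrAC ltr_pdivlMr//; lra.
  have [||t [t0 nt tp]] := @lt_seq_between [seq sx l / - l n | l <- neg]
      [seq - sx l / l n | l <- pos] 0.
  + move=> _ /mapP[l lp ->]; have := lp; rewrite mem_filter => /andP[l0 _].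
    by rewrite divr_gt0// oppr_gt0 pos_lt.
  + by move=> _ _ /mapP[l' ln ->] /mapP[l lp ->]; exact: comb_lt.
  have [|l lls] := hx (fun i => if i == n then t else x i).
    by move=> i; case: ifP => // _; exact: ltW.
  rewrite big_ord_recr/= eqxx (eq_bigr (fun i : 'I_n => l i * x i)); last first.
    by move=> i _; rewrite ltn_eqF.
  rewrite -/(sx l) leNgt => /negP; apply.
  have [l0|l0|l0] := ltgtP (l n) 0.
  + have /nt : sx l / - l n \in [seq sx l / - l n | l <- neg].
      by apply/map_f; rewrite mem_filter l0.
    by rewrite ltr_pdivrMr ?oppr_gt0//; lra.
  + have /tp : - sx l / l n \in [seq - sx l / l n | l <- pos].
      by apply/map_f; rewrite mem_filter l0.
    by rewrite ltr_pdivlMr//; lra.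
  + by rewrite l0 mul0r addr0; apply: hlt; rewrite mem_cat mem_filter l0 lexx lls.
- move=> l; rewrite mem_cat => /orP[|/allpairsP[[l1 l2]/= [+ + ->]]].
    rewrite mem_filter => /andP[l0 /hz]; rewrite big_ord_recr/=.
    apply: le_trans; rewrite -[leLHS]addr0 bl_leD2l bl_scale_ge0//.
  rewrite !mem_filter => /andP[l10 /hz l1z] /andP[l20 /hz l2z].
  have D0 : 0 < l1 n - l2 n by lra.
  have -> : \sum_(i < n) comb l1 l2 i *: a i =
      (l1 n / (l1 n - l2 n)) *: (\sum_(i < n.+1) l2 i *: a i) +
      (- l2 n / (l1 n - l2 n)) *: (\sum_(i < n.+1) l1 i *: a i).
    rewrite !scaler_sumr -big_split/= big_ord_recr/= !scalerA -!scalerDl.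
    rewrite [X in X *: a n](_ : _ = 0); last by ring.
    rewrite scale0r addr0; apply: eq_bigr => i _.
    by rewrite !scalerA -!scalerDl /comb; congr (_ *: _); ring.
  have -> : z = (l1 n / (l1 n - l2 n)) *: z + (- l2 n / (l1 n - l2 n)) *: z.
    by rewrite -scalerDl -mulrDl divff ?scale1r ?gt_eqF.
  by apply: bl_leD; apply: bl_leZ => //; rewrite divr_ge0; lra.
Qed.

End Elimination.

(** * Meets of joins as normal form of lattice-linear expressions *)

Section NormalForm.
Context {R : realType} {F : banachLatticeType R} {X : Type}.
Implicit Types (p q r : (X -> R) * F) (lin : set ((X -> R) * F)).

(** A pair holds one lattice-linear expression evaluated twice, pointwise on [X] and in [F]. *)
Definition pair_join p q : (X -> R) * F :=
  (fun x => Num.max (p.1 x) (q.1 x), Order.join p.2 q.2).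
Definition pair_meet p q : (X -> R) * F :=
  (fun x => Num.min (p.1 x) (q.1 x), Order.meet p.2 q.2).

Inductive join_form lin : (X -> R) * F -> Prop :=
| join_form_lin p : lin p -> join_form lin p
| join_form_join p q : join_form lin p -> join_form lin q ->
    join_form lin (pair_join p q).

Inductive meet_join_form lin : (X -> R) * F -> Prop :=
| meet_join_form_join p : join_form lin p -> meet_join_form lin p
| meet_join_form_meet p q : meet_join_form lin p -> meet_join_form lin q ->
    meet_join_form lin (pair_meet p q).

Lemma pair_joinC p q : pair_join p q = pair_join q p.
Proof. by congr pair; [apply/funext => x; rewrite maxC|rewrite joinC]. Qed.

Lemma pair_joinDr p q r : pair_join p q + r = pair_join (p + r) (q + r).
Proof. by congr pair; [apply/funext => x; exact: addr_maxl|rewrite bl_joinDr]. Qed.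

Lemma pair_meetDr p q r : pair_meet p q + r = pair_meet (p + r) (q + r).
Proof. by congr pair; [apply/funext => x; exact: addr_minl|rewrite bl_meetDr]. Qed.

Lemma pair_scale_join c p q : 0 <= c ->
  c *: pair_join p q = pair_join (c *: p) (c *: q).
Proof.
move=> c0; congr pair; last exact: bl_scale_join.
by apply/funext => x; exact: maxr_pMr.
Qed.

Lemma pair_scale_meet c p q : 0 <= c ->
  c *: pair_meet p q = pair_meet (c *: p) (c *: q).
Proof.
move=> c0; congr pair; last exact: bl_scale_meet.
by apply/funext => x; exact: minr_pMr.
Qed.

Lemma pair_oppr_join p q : - pair_join p q = pair_meet (- p) (- q).
Proof. by congr pair; [apply/funext => x; exact: oppr_max|rewrite bl_oppr_join]. Qed.

Lemma pair_oppr_meet p q : - pair_meet p q = pair_join (- p) (- q).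
Proof. by congr pair; [apply/funext => x; exact: oppr_min|rewrite bl_oppr_meet]. Qed.

Lemma pair_joinIl p q r :
  pair_join (pair_meet p q) r = pair_meet (pair_join p r) (pair_join q r).
Proof. by congr pair; [apply/funext => x; rewrite /= max_minl|rewrite bl_joinIl]. Qed.

Section Closure.
Context {lin : set ((X -> R) * F)} (hlin : subspace lin).
Local Notation J := (join_form lin).
Local Notation N := (meet_join_form lin).

Lemma join_formD p q : J p -> J q -> J (p + q).
Proof.
move=> Jp Jq; elim: Jp => {p}[p lp|p1 p2 _ J1 _ J2]; last first.
  by rewrite pair_joinDr; exact: join_form_join.
elim: Jq => {q}[q lq|q1 q2 _ J1 _ J2]; last first.
  by rewrite addrC pair_joinDr; apply: join_form_join; rewrite addrC.
exact/join_form_lin/subspaceD.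
Qed.

Lemma meet_join_formD p q : N p -> N q -> N (p + q).
Proof.
move=> Np Nq; elim: Np => {p}[p Jp|p1 p2 _ N1 _ N2]; last first.
  by rewrite pair_meetDr; exact: meet_join_form_meet.
elim: Nq => {q}[q Jq|q1 q2 _ N1 _ N2]; last first.
  by rewrite addrC pair_meetDr; apply: meet_join_form_meet; rewrite addrC.
exact/meet_join_form_join/join_formD.
Qed.

Lemma meet_join_form_pair_join p q : N p -> N q -> N (pair_join p q).
Proof.
move=> Np Nq; elim: Np => {p}[p Jp|p1 p2 _ N1 _ N2]; last first.
  by rewrite pair_joinIl; exact: meet_join_form_meet.
elim: Nq => {q}[q Jq|q1 q2 _ N1 _ N2]; last first.
  rewrite pair_joinC pair_joinIl.
  by apply: meet_join_form_meet; rewrite pair_joinC.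
exact/meet_join_form_join/join_form_join.
Qed.

Lemma meet_join_form_lin p : lin p -> N p.
Proof. by move=> lp; exact/meet_join_form_join/join_form_lin. Qed.

(** Negation turns a meet of joins into a join of meets; stability under [pair_join], due to
    distributivity, restores the normal form. *)
Lemma meet_join_formN p : N p -> N (- p).
Proof.
elim=> {p}[p|p q _ N1 _ N2]; last first.
  by rewrite pair_oppr_meet; exact: meet_join_form_pair_join.
elim=> {p}[p lp|p q _ N1 _ N2]; first exact/meet_join_form_lin/subspaceN.
by rewrite pair_oppr_join; exact: meet_join_form_meet.
Qed.

Lemma meet_join_formZ_ge0 c p : 0 <= c -> N p -> N (c *: p).
Proof.
move=> c0; elim=> {p}[p|p q _ N1 _ N2]; last first.
  by rewrite pair_scale_meet//; exact: meet_join_form_meet.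
elim=> {p}[p lp|p q _ N1 _ N2]; first exact/meet_join_form_lin/subspaceZ.
by rewrite pair_scale_join//; exact: meet_join_form_pair_join.
Qed.

Lemma meet_join_form_subspace : subspace N.
Proof.
split; first exact/meet_join_form_lin/subspace0.
move=> c p q Np Nq; apply: meet_join_formD => //.
have [c0|/ltW c0] := leP 0 c; first exact: meet_join_formZ_ge0.
rewrite -[c]opprK scaleNr; apply/meet_join_formN/meet_join_formZ_ge0 => //.
by rewrite oppr_ge0.
Qed.

End Closure.
End NormalForm.

(** * Linear spans *)

Section LinearSpan.
Context {R : realType} {F : banachLatticeType R}.
Implicit Types A B P : set F.

Lemma lspan_min A P : subspace P -> A `<=` P -> lspan A `<=` P.
Proof.
move=> hP AP _ [n [c [a [Aa ->]]]]; apply: subspace_sum => // i _.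
by apply: subspaceZ => //; exact: AP.
Qed.

Lemma subset_lspan A : A `<=` lspan A.
Proof.
move=> f Af; exists 1%N, (fun=> 1), (fun=> f); split=> //.
by rewrite big_ord1 scale1r.
Qed.

Lemma lspan_subspace A : subspace (lspan A).
Proof.
split; first by exists 0%N, (fun=> 0), (fun=> 0); rewrite big_ord0; split=> // -[].
move=> k _ _ [m [c [a [Aa ->]]]] [n [d [b [Ab ->]]]].
exists (m + n)%N,
  (fun i => match fintype.split i with inl j => k * c j | inr j => d j end),
  (fun i => match fintype.split i with inl j => a j | inr j => b j end); split.
  by move=> i; case: (fintype.split i).
rewrite big_split_ord/= scaler_sumr; congr (_ + _); apply: eq_bigr => i _.
  by rewrite (unsplitK (inl _ i)) scalerA.
by rewrite (unsplitK (inr _ i)).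
Qed.

Lemma lspanS A B : A `<=` B -> lspan A `<=` lspan B.
Proof.
by move=> AB; apply: lspan_min (lspan_subspace B) _ => f /AB/subset_lspan.
Qed.

End LinearSpan.

(** * Transfer of inequalities from the simplex to the Banach lattice *)

Section SimplexModel.
Context {R : realType} {F : banachLatticeType R} (s : seq F).
Hypothesis s0 : forall f, f \in s -> 0 <= f.

Let n := size s.
Let a i : F := nth 0 s i.

(** Points are functions on all of [nat], as in [max_linear_ge0]; coordinates from [n] on enter no
    sum. For empty [s] there are no points. *)
Definition simplex : Type :=
  {x : nat -> R | (forall i, 0 <= x i) /\ \sum_(i < n) x i = 1}.

Definition linear_fct (u : nat -> R) : simplex -> R :=
  fun x => \sum_(i < n) u i * sval x i.

Definition linear_pair (u : nat -> R) : (simplex -> R) * F :=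
  (linear_fct u, \sum_(i < n) u i *: a i).

Let lin := range linear_pair.
Let V := range linear_fct.
Local Notation N := (meet_join_form lin).

Lemma nth_seq_ge0 i : 0 <= a i.
Proof.
rewrite /a; have [si|si] := ltnP i (size s); last by rewrite nth_default.
by rewrite s0// mem_nth.
Qed.

Lemma linear_pair_subspace : subspace lin.
Proof.
split.
  exists (fun=> 0) => //; congr pair; last by apply: big1 => i _; rewrite scale0r.
  by apply/funext => x; apply: big1 => i _; rewrite mul0r.
move=> k _ _ [u _ <-] [v _ <-]; exists (fun i => k * u i + v i) => //.
congr pair.
  apply/funext => x; rewrite -[RHS]/(k * linear_fct u x + linear_fct v x).
  rewrite /linear_fct mulr_sumr -big_split/=; apply: eq_bigr => i _.
  by rewrite mulrDl mulrA.
rewrite -[RHS]/(k *: (\sum_(i < n) u i *: a i) + \sum_(i < n) v i *: a i).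
rewrite scaler_sumr -big_split/=; apply: eq_bigr => i _.
by rewrite scalerDl scalerA.
Qed.

Lemma linear_fct_subspace : subspace V.
Proof.
have [[u _ u0] linD] := linear_pair_subspace.
split; first by exists u => //; case: u0.
move=> k _ _ [v _ <-] [w _ <-].
have [t _ [tE _]] := linD k _ _ (imageT linear_pair v) (imageT linear_pair w).
by exists t.
Qed.

Lemma linear_fct1 : V (cst 1).
Proof.
exists (fun=> 1) => //; apply/funext => x; rewrite /linear_fct.
by under eq_bigr do rewrite mul1r; case: (svalP x).
Qed.

Lemma linear_fct_bounded v : V v -> bounded_fct v.
Proof.
move=> [u _ <-]; exists (\sum_(i < n) `|u i|) => x.
rewrite (le_trans (ler_norm_sum _ _ _))//; apply: ler_sum => i _.
have [x0 x1] := svalP x; rewrite normrM (ger0_norm (x0 i)).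
apply: ler_piMr => //; rewrite -[leRHS]x1 (bigD1 i)//= lerDl.
exact: sumr_ge0.
Qed.

Lemma lspan_linear :
  lspan [set` s] `<=` range (fun u => (linear_pair u).2).
Proof.
apply: lspan_min => [|f /= fs].
  have [[u _ u0] linD] := linear_pair_subspace; split; first by exists u; rewrite ?u0.
  move=> k _ _ [v _ <-] [w _ <-].
  have [t _ tE] := linD k _ _ (imageT linear_pair v) (imageT linear_pair w).
  by exists t; rewrite ?tE.
have fn : (index f s < n)%N by rewrite index_mem.
exists (fun i => (i == index f s)%:R) => //=.
rewrite (bigD1 (Ordinal fn))//= eqxx scale1r /a nth_index// big1 ?addr0// => i.
by rewrite -val_eqE/= => /negPf ->; rewrite scale0r.
Qed.

(** Prepares the hypotheses of [max_linear_ge0]: at each point the join is attained by one of its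
    forms, and in [F] it dominates all of them. *)
Lemma join_form_linear p : join_form lin p ->
  exists ls : seq (nat -> R), [/\ ls != [::],
    forall x, exists2 l, l \in ls & p.1 x = linear_fct l x &
    forall l, l \in ls -> \sum_(i < n) l i *: a i <= p.2].
Proof.
elim=> {p}[_ [u _ <-]|p q _ [lp [lp0 pE ple]] _ [lq [lq0 qE qle]]].
  exists [:: u]; split=> //; last by move=> l; rewrite inE => /eqP ->.
  by move=> x; exists u => //; rewrite inE.
exists (lp ++ lq); split; first by case: lp lp0 {pE ple}.
  move=> x; rewrite /= maxEle; case: ifP => _.
    by have [l lql ->] := qE x; exists l => //; rewrite mem_cat lql orbT.
  by have [l lpl ->] := pE x; exists l => //; rewrite mem_cat lpl.
move=> l; rewrite mem_cat => /orP[/ple|/qle] /le_trans -> //.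
  exact: leUl.
exact: leUr.
Qed.

(** A meet is nonnegative as soon as both parts are, which leaves joins. For these, homogeneity
    extends the hypothesis from the simplex to the whole orthant. *)
Lemma meet_join_form_ge0 p : N p -> (forall x, 0 <= p.1 x) -> 0 <= p.2.
Proof.
elim=> {p}[p /join_form_linear[ls [ls0 lsE lsle]] p0|p q _ IHp _ IHq pq0].
  apply: (max_linear_ge0 nth_seq_ge0 _ lsle) => x x0.
  (* A point with zero sum cannot be normalised, but every form vanishes there, so any member of the
     nonempty [ls] serves. *)
  have [sx0|sx0] := eqVneq (\sum_(i < n) x i) 0.
    case: ls ls0 {lsE lsle} => // l ls _; exists l; first exact: mem_head.
    rewrite big1// => i _; move: sx0 => /psumr_eq0P -> //; exact: mulr0.
  have sx1 : 0 < \sum_(i < n) x i by rewrite lt0r sx0 sumr_ge0.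
  pose y i := x i / \sum_(j < n) x j.
  have hy : (forall i, 0 <= y i) /\ \sum_(i < n) y i = 1.
    by split=> [i|]; [rewrite divr_ge0// ltW|rewrite -mulr_suml divff].
  have [l lls lE] := lsE (exist _ y hy); exists l => //.
  have := p0 (exist _ y hy); rewrite lE /linear_fct/=.
  under eq_bigr do rewrite mulrA.
  by rewrite -mulr_suml pmulr_lge0// invr_gt0.
rewrite lexI IHp ?IHq// => x; have := pq0 x; rewrite /= le_min => /andP[]//.
Qed.

Lemma meet_join_form_abs p : N p -> N (fun x => `|p.1 x|, bl_abs p.2).
Proof.
move=> Np; have -> : (fun x => `|p.1 x|, bl_abs p.2) = pair_join p (- p).
  by congr pair; apply/funext => x; rewrite /= -maxrN.
apply: meet_join_form_pair_join => //.
exact: meet_join_formN linear_pair_subspace _ _.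
Qed.

Lemma bl_abs_approx (L : set F) p e : subspace L ->
  (forall u, L (linear_pair u).2) ->
  (forall u, L (bl_abs (linear_pair u).2)) ->
  N p -> uniform_algebra V p.1 -> 0 < e ->
  exists2 y, L y & `|bl_abs p.2 - y| <= e.
Proof.
move=> hL Llin Labs Np Vp e0.
have hN : subspace N := meet_join_form_subspace linear_pair_subspace.
(* Asking only for some partner [y] in [L] avoids having to define a map from functions to [F]. *)
pose S := [set h : simplex -> R | exists2 y, L y & N (h, y)].
have hS : subspace S.
  split; first by exists 0; [exact: subspace0|exact: (subspace0 hN)].
  move=> k f g [y Ly Ny] [z Lz Nz]; exists (k *: y + z); first exact: hL.2.
  exact: (hN.2 k _ _ Ny Nz).
have Nlin u : N (linear_pair u) by apply/meet_join_form_lin/imageT.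
have VS : V `<=` S.
  by move=> _ [u _ <-]; exists (linear_pair u).2; [exact: Llin|exact: Nlin].
have absS v : V v -> S (fun x => `|v x|).
  move=> [u _ <-]; exists (bl_abs (linear_pair u).2) => //.
  exact: (meet_join_form_abs (Nlin u)).
pose E := linear_pair (fun=> 1).
have E1 x : E.1 x = 1.
  by rewrite /= /linear_fct; under eq_bigr do rewrite mul1r; case: (svalP x).
have E0 : 0 <= E.2 by apply: bl_sum_ge0 => i _; rewrite scale1r nth_seq_ge0.
(* The order bound [d *: E.2] obtained below has norm at most [e]; the added [1] covers
   [E.2 = 0]. *)
pose d := e / (`|E.2| + 1).
have d0 : 0 < d by rewrite divr_gt0// ltr_wpDl.
have Vabs := uniform_algebra_abs linear_fct_subspace linear_fct1 linear_fct_bounded Vp.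
have [h [y Ly Ny] hy] := uniform_algebra_modulus linear_fct_subspace linear_fct1
  linear_fct_bounded hS VS absS Vabs d0.
exists y => //.
have ND := subspaceB hN (meet_join_form_abs Np) Ny.
set D := _ - _ in ND.
have NE := subspaceZ hN d (Nlin (fun=> 1)).
(* Since [E] is the constant [1] on the simplex, uniform bounds there become order bounds by
   multiples of [E.2]. *)
have key q : N q -> (forall x, q.1 x <= d) -> q.2 <= d *: E.2.
  move=> Nq qd; rewrite -bl_subr_ge0.
  apply: (meet_join_form_ge0 (subspaceB hN NE Nq)) => x.
  rewrite -[leRHS]/(d * E.1 x - q.1 x) E1 mulr1 subr_ge0; exact: qd.
have D1 x : `|D.1 x| <= d by exact: hy.
have DE : bl_abs D.2 <= d *: E.2.
  rewrite bl_abs_le key//= ?(key (- D)) //.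
  - exact: subspaceN.
  - by move=> x; apply: le_trans (D1 x); rewrite -normrN ler_norm.
  - by move=> x; apply: le_trans (D1 x); rewrite ler_norm.
have : `|D.2| <= `|d *: E.2|.
  by apply: bl_norm_le; rewrite (bl_ge0_abs (bl_scale_ge0 (ltW d0) E0)).
move=> /le_trans; apply; rewrite normrZ gtr0_norm//.
rewrite /d mulrAC ler_pdivrMr ?ltr_wpDl// ler_pM2l//; lra.
Qed.

End SimplexModel.

(** * The span of the image of [Phi] *)

Section PhiSpan.
Context {R : realType} {F : banachLatticeType R}.
Implicit Types (A : set F) (r s : R) (f : F).

Lemma PhiE r s f :
  Phi r s f = (2^-1 * (r + s)) *: bl_abs f + (2^-1 * (r - s)) *: f.
Proof.
rewrite /Phi bl_pospart bl_negpart !scalerA !scalerBr !scalerDr addrACA -scalerBl.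
by rewrite -scalerDl; congr (_ *: _ + _ *: _); ring.
Qed.

(** Adding the values of [Phi] at [f] and [- f] cancels the odd part in [PhiE] and leaves [(r + s)]
    times the modulus. *)
Lemma lspan_Phi_abs A r s f : r + s != 0 -> lspan A f ->
  lspan (Phi r s @` lspan A) (bl_abs f).
Proof.
move=> rs Af; have hL := lspan_subspace (Phi r s @` lspan A).
have -> : bl_abs f = (r + s)^-1 *: (Phi r s f + Phi r s (- f)).
  rewrite !PhiE bl_absN scalerN addrACA subrr addr0 -scalerDl scalerA.
  by rewrite [_ * _](_ : _ = 1) ?scale1r//; field.
apply/(subspaceZ hL)/(subspaceD hL); apply: subset_lspan; apply: imageP => //.
exact/subspaceN/Af/lspan_subspace.
Qed.

Lemma lspan_Phi_base A r s : r + s != 0 -> A `<=` [set f | 0 <= f] ->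
  lspan A `<=` lspan (Phi r s @` lspan A).
Proof.
move=> rs A0; apply: lspan_min (lspan_subspace _) _ => f Af.
by rewrite -(bl_ge0_abs (A0 _ Af)); apply/lspan_Phi_abs/subset_lspan.
Qed.

(** Only finitely many generators occur in [f], as the simplex model requires; concatenated lists
    serve for sums. *)
Lemma lspan_Phi_finite A r s f : lspan (Phi r s @` lspan A) f ->
  exists2 t : seq F, (forall g, g \in t -> A g) &
    lspan (Phi r s @` lspan [set` t]) f.
Proof.
have mono (t u : seq F) : {subset t <= u} ->
    lspan [set` t] `<=` lspan [set` u] /\
    lspan (Phi r s @` lspan [set` t]) `<=` lspan (Phi r s @` lspan [set` u]).
  move=> tu; have h : lspan [set` t] `<=` lspan [set` u] by apply: lspanS => x /tu.
  by split => //; apply/lspanS/image_subset.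
have catl (t u : seq F) : {subset t <= t ++ u}.
  by move=> x xt; rewrite mem_cat xt.
have catr (t u : seq F) : {subset u <= t ++ u}.
  by move=> x xt; rewrite mem_cat xt orbT.
have cat_A (t u : seq F) : (forall g, g \in t -> A g) ->
    (forall g, g \in u -> A g) -> forall g, g \in t ++ u -> A g.
  by move=> tA uA g; rewrite mem_cat => /orP[/tA|/uA].
pose P := [set f | exists2 t : seq F, (forall g, g \in t -> A g) &
    lspan [set` t] f].
have hP : subspace P.
  split; first by exists [::] => //; exact: subspace0 (lspan_subspace _).
  move=> k u v [t tA tu] [t' t'A t'v]; exists (t ++ t'); first exact: cat_A.
  apply: (lspan_subspace _).2; first exact: (mono _ _ (catl t t')).1.
  exact: (mono _ _ (catr t t')).1.
have AP : lspan A `<=` P.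
  apply: lspan_min hP _ => g Ag; exists [:: g].
    by move=> h; rewrite inE => /eqP->.
  by apply: subset_lspan; rewrite /= mem_head.
pose Q := [set f | exists2 t : seq F, (forall g, g \in t -> A g) &
    lspan (Phi r s @` lspan [set` t]) f].
suff : lspan (Phi r s @` lspan A) `<=` Q by apply.
apply: lspan_min => [|_ [g /AP[t tA tg] <-]]; last first.
  by exists t => //; exact/subset_lspan/imageP.
split; first by exists [::] => //; exact: subspace0 (lspan_subspace _).
move=> k u v [t tA tu] [t' t'A t'v]; exists (t ++ t'); first exact: cat_A.
apply: (lspan_subspace _).2; first exact: (mono _ _ (catl t t')).2.
exact: (mono _ _ (catr t t')).2.
Qed.

Lemma lspan_Phi_abs_approx A r s f e : r + s != 0 -> A `<=` [set f | 0 <= f] ->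
  lspan (Phi r s @` lspan A) f -> 0 < e ->
  exists2 g, lspan (Phi r s @` lspan A) g & `|bl_abs f - g| <= e.
Proof.
move=> rs A0 /lspan_Phi_finite[t tA tf] e0.
have t0 g : g \in t -> 0 <= g by move=> /tA/A0.
set V := range (@linear_fct _ _ t); set lin := range (@linear_pair _ _ t).
have hlin := linear_pair_subspace t.
have hN := meet_join_form_subspace hlin.
have hV := linear_fct_subspace t; have V1 := linear_fct1 t.
have Vbd := @linear_fct_bounded _ _ t.
have lin_span u : lspan A (linear_pair t u).2.
  apply: (subspace_sum (lspan_subspace A)) => i _.
  by apply/(subspaceZ (lspan_subspace A))/subset_lspan/tA/mem_nth.
(* By [PhiE], [f] combines elements of the span of [t] and their moduli; performing the same
   operations on pairs yields a function in the algebra. *)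
have [p [Np Vp pf]] : exists p, [/\ meet_join_form lin p,
    uniform_algebra V p.1 & p.2 = f].
  move: tf; apply: (@lspan_min _ _ _ [set f | exists p,
    [/\ meet_join_form lin p, uniform_algebra V p.1 & p.2 = f]]).
    split.
      exists 0; split=> //; first exact: (subspace0 hN).
      exact: uniform_algebra_base (subspace0 hV).
    move=> k _ _ [p [Np Vp <-]] [q [Nq Vq <-]]; exists (k *: p + q); split=> //.
      exact: hN.2.
    exact: uniform_algebraD (uniform_algebraZ hV V1 k Vp) Vq.
  move=> _ [_ /lspan_linear[u _ <-] <-]; set q := linear_pair t u.
  have Nq : meet_join_form lin q by apply/meet_join_form_lin/imageT.
  have Vq : uniform_algebra V q.1 by apply/uniform_algebra_base/imageT.
  exists ((2^-1 * (r + s)) *: (fun x => `|q.1 x|, bl_abs q.2) +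
          (2^-1 * (r - s)) *: q); split.
  - apply: (subspaceD hN); apply: (subspaceZ hN) => //.
    exact: meet_join_form_abs.
  - apply: uniform_algebraD; apply: uniform_algebraZ => //.
    exact: uniform_algebra_abs.
  - by rewrite PhiE.
rewrite -pf; apply: (bl_abs_approx t0 (lspan_subspace _)) => //.
  by move=> u; apply: lspan_Phi_base.
by move=> u; apply: lspan_Phi_abs.
Qed.

End PhiSpan.

(** * Norm closures of subspaces and sublattices *)

Lemma closure_normP {R : realType} {F : normedModType R} (M : set F) (f : F) :
  closure M f <-> forall e : R, 0 < e -> exists2 g, M g & `|f - g| <= e.
Proof.
split=> [Mf e e0|Mf B /nbhs_ballP[e /= e0 eB]].
  have [g [Mg]] := Mf _ (nbhsx_ballx f e e0).
  by rewrite -ball_normE/= => /ltW fg; exists g.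
have [|g Mg fg] := Mf (e / 2); first by rewrite divr_gt0.
exists g; split=> //; apply: eB; rewrite -ball_normE/=.
by apply: le_lt_trans fg _; lra.
Qed.

Lemma closure_subspace {R : realType} {F : normedModType R} (M : set F) :
  subspace M -> subspace (closure M).
Proof.
move=> hM; split; first exact/subset_closure/subspace0.
move=> a u v /closure_normP Mu /closure_normP Mv; apply/closure_normP => e e0.
have a0 : 0 < `|a| + 1 by rewrite ltr_wpDl.
have [|u' Mu' uu'] := Mu (e / 2 / (`|a| + 1)); first by rewrite !divr_gt0.
have [|v' Mv' vv'] := Mv (e / 2); first by rewrite divr_gt0.
exists (a *: u' + v'); first exact: hM.2.
rewrite opprD addrACA -scalerBr (le_trans (ler_normD _ _))// normrZ.
rewrite [leRHS]splitr lerD//.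
rewrite -[leRHS](divfK (lt0r_neq0 a0)) mulrC ler_pM// lerDl//.
Qed.

Section SublatticeClosure.
Context {R : realType} {F : banachLatticeType R}.
Implicit Types (A M : set F) (r s : R).

(** The modulus is 1-Lipschitz in norm, by [bl_abs_dist] and monotonicity of the norm. *)
Lemma closure_bl_abs M f : (forall g, M g -> closure M (bl_abs g)) ->
  closure M f -> closure M (bl_abs f).
Proof.
move=> Mabs /closure_normP Mf; apply/closure_normP => e e0.
have e20 : 0 < e / 2 by lra.
have [g Mg fg] := Mf _ e20.
have /closure_normP/(_ _ e20)[h Mh gh] := Mabs _ Mg.
exists h => //; rewrite -(subrKA (bl_abs g)) (le_trans (ler_normD _ _))//.
have := bl_norm_le (bl_abs_dist f g).
lra.
Qed.

Lemma linear_sublatticeP M : linear_sublattice M <->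
  subspace M /\ forall f, M f -> M (bl_abs f).
Proof.
split=> [[[M0 ML] _ Mj]|[hM Mabs]].
  have hM : subspace M.
    split; first by have := M0; rewrite inE.
    by move=> a u v Mu Mv; have := ML a u v; rewrite !inE; exact.
  split=> // f Mf; have := Mj f (- f); rewrite !inE; apply => //.
  exact: subspaceN.
have join u v : M u -> M v -> M (Order.join u v).
  move=> Mu Mv; rewrite bl_joinE; apply: (subspaceZ hM).
  by apply: (subspaceD hM); [exact: subspaceD|exact/Mabs/subspaceB].
split; first split.
- by rewrite inE; exact: subspace0.
- by move=> a u v; rewrite !inE; exact: hM.2.
- move=> u v; rewrite !inE => Mu Mv; rewrite -[Order.meet u v]opprK bl_oppr_meet.
  by apply/(subspaceN hM)/join; exact: subspaceN.
- by move=> u v; rewrite !inE; exact: join.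
Qed.

End SublatticeClosure.

Unset Implicit Arguments.

Theorem corollary3p3 (R : realType) (F : banachLatticeType R) (A : set F)
    (hA : A `<=` [set f | 0 <= f]) (r s : R) (hrs : s <> - r) :
  closure (lspan (Phi r s @` lspan A)) = closed_sublattice_generated A.
Proof.
have rs : r + s != 0.
  by apply/eqP => rs0; apply: hrs; apply/eqP; rewrite -addr_eq0 addrC rs0.
have [[clG /linear_sublatticeP[hG Gabs]] AG Gmin] :=
  closed_sublattice_generated_smallest A.
apply/seteqP; split.
  (* The generated sublattice is closed and contains each [Phi r s f], a combination of [f] and its
     modulus. *)
  rewrite [X in _ `<=` X](closure_id _).1//; apply: closureS.
  apply: (lspan_min hG) => _ [f Af <-]; rewrite PhiE.
  have Gf := lspan_min hG AG Af.
  by apply: (subspaceD hG); apply: (subspaceZ hG) => //; exact: Gabs.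
(* Conversely, by minimality it suffices that the closure is a closed sublattice containing [A];
   approximating moduli of elements of the span is enough. *)
apply: Gmin; last first.
  by move=> f Af; apply/subset_closure/lspan_Phi_base/subset_lspan.
split; first exact: closed_closure.
apply/linear_sublatticeP; split; first exact/closure_subspace/lspan_subspace.
move=> f; apply: closure_bl_abs => g Lg; apply/closure_normP => e.
exact: lspan_Phi_abs_approx.
Qed.
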